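(* Let $M,N\ge1$ be integers, $P,\sigma^2,\beta_1,\beta_2>0$, let $\mathbf{a}_1,\mathbf{a}_{2,2}\in\mathbb{C}^N$ and $\mathbf{a}_{2,1}\in\mathbb{C}^M$ have unit-modulus entries, and let $\mathbf{h}_3\in\mathbb{C}^M$. Put $\mathbf{h}_1=\sqrt{\beta_1}\,\mathbf{a}_1$ and $\mathbf{H}_2=\sqrt{\beta_2}\,\mathbf{a}_{2,1}\mathbf{a}_{2,2}^{T}$. Over all $\mathbf{\Psi}=\mathrm{diag}(\psi_1,\dots,\psi_N)$ with $|\psi_n|=1$ for all $n$, the SNR $\frac{P}{\sigma^2}\|\mathbf{h}_3+\mathbf{H}_2\mathbf{\Psi}\mathbf{h}_1\|^2$ is maximized by $$\psi_n=\exp\left(\mathsf{j}\left(-\angle[\mathbf{a}_1]_n-\angle[\mathbf{a}_{2,2}]_n-\angle(\mathbf{h}_3^{H}\mathbf{a}_{2,1})\right)\right),\quad n=1,\dots,N,$$ and the maximum value is $$\mathrm{SNR}_{\rm P\text{-}RIS}=\frac{P\left(\|\mathbf{h}_3\|^2+\beta_1\beta_2N^2M+2\sqrt{\beta_1\beta_2}\,N\,|\mathbf{h}_3^{H}\mathbf{a}_{2,1}|\right)}{\sigma^2}.$$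
   Context: $\mathsf{j}$ is the imaginary unit, $\angle z$ is the argument of $z\in\mathbb{C}$ (any value may be used if $z=0$), $[\mathbf{a}]_n$ is the $n$-th entry of $\mathbf{a}$, $(\cdot)^T$ and $(\cdot)^H$ are the transpose and conjugate transpose, and $\|\cdot\|$ is the Euclidean norm. The setting is uplink communication assisted by a passive RIS in the presence of a direct user–base-station channel $\mathbf{h}_3$, with maximum-ratio combining. *)

(* Defs.v *)
From mathcomp Require Import all_boot all_order all_algebra.
From mathcomp Require Import sesquilinear spectral complex.
From mathcomp Require Import reals trigo.

Set Implicit Arguments.
Unset Strict Implicit.
Unset Printing Implicit Defensive.

Import Order.TTheory GRing.Theory Num.Theory.
Local Open Scope ring_scope.
Local Open Scope complex_scope.
Local Open Scope sesquilinear_scope.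

Section RISModel.
Variable R : realType.

(* R-valued modulus: the norm `|z| of R[i] takes its values in R[i]. *)
Definition cabs (z : R[i]) : R := Normc.normc z.

(* exp(j t), through Euler's formula. *)
Definition expj (t : R) : R[i] := cos t +i* sin t.

(* t is an argument of z, determined up to 2 pi when z != 0;
   every t is an argument of 0. *)
Definition is_arg (z : R[i]) (t : R) : Prop := z = (cabs z)%:C * expj t.

Definition enorm n (v : 'cV[R[i]]_n) : R :=
  Num.sqrt (\sum_(i < n) cabs (v i 0) ^+ 2).

(* u^H v as a scalar; ^t* is the conjugate transpose. *)
Definition hdot n (u v : 'cV[R[i]]_n) : R[i] := (u^t* *m v) 0 0.

Definition unimodular m n (A : 'M[R[i]]_(m, n)) : Prop :=
  forall i j, cabs (A i j) = 1.

(* The row psi lists the diagonal of the matrix Psi. *)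
Definition SNR M N (P sigma2 : R) (h3 : 'cV[R[i]]_M) (H2 : 'M[R[i]]_(M, N))
    (h1 : 'cV[R[i]]_N) (psi : 'rV[R[i]]_N) : R :=
  P / sigma2 * enorm (h3 + H2 *m diag_mx psi *m h1) ^+ 2.

Lemma is_arg_ex (z : R[i]) : exists t, is_arg z t.
Proof.
case: z => a b; rewrite /is_arg /cabs /expj /=.
set r := Num.sqrt _.
have r2 : r ^+ 2 = a ^+ 2 + b ^+ 2 by rewrite sqr_sqrtr // addr_ge0 ?sqr_ge0.
have r_ge0 : 0 <= r by exact: sqrtr_ge0.
have [r0|r_neq0] := eqVneq r 0.
  have : a ^+ 2 + b ^+ 2 == 0 by rewrite -r2 r0 expr0n.
  rewrite paddr_eq0 ?sqr_ge0 // !sqrf_eq0 => /andP[/eqP -> /eqP ->].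
  by exists 0; rewrite r0 mul0r.
have r_gt0 : 0 < r by rewrite lt_def r_neq0.
have ar : -1 <= a / r <= 1.
  rewrite -ler_norml normrM normfV (ger0_norm r_ge0) ler_pdivrMr // mul1r.
  by rewrite -(@ler_pXn2r _ 2) ?nnegrE // real_normK ?num_real // r2 lerDl sqr_ge0.
have sE : sin (acos (a / r)) = `|b| / r.
  rewrite sin_acos // -[in X in Num.sqrt X](divff (expf_neq0 2 r_neq0)).
  rewrite expr_div_n -mulrBl r2 addrAC subrr add0r -r2 -expr_div_n sqrtr_sqr.
  by rewrite normrM normfV (ger0_norm r_ge0).
have cE : cos (acos (a / r)) = a / r by rewrite acosK // in_itv.
have [b_ge0|b_lt0] := leP 0 b.
  exists (acos (a / r)); rewrite cE sE ger0_norm //.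
  by simpc; rewrite !(mulrC r) !divfK.
exists (- acos (a / r)); rewrite cosN sinN cE sE ltr0_norm // mulNr opprK.
by simpc; rewrite !(mulrC r) !divfK.
Qed.

End RISModel.

(* Main.v *)
Require Import Defs.
From mathcomp Require Import all_boot all_order all_algebra.
From mathcomp Require Import sesquilinear spectral complex.
From mathcomp Require Import reals trigo.
From mathcomp Require Import ring.

Import Order.TTheory GRing.Theory Num.Theory.
Local Open Scope ring_scope.
Local Open Scope complex_scope.

(** Since the cascaded channel has rank one, [H2 Psi h1] equals [c a21] with
    [c] equal to [sqrt (beta1 beta2)] times the sum of the [N] unit-modulus
    numbers [a22_n psi_n a1_n].  Expanding the square gives
    [|h3 + c a21|^2 = |h3|^2 + |c|^2 M + 2 Re (c h3^H a21)], where
    [|c| <= sqrt (beta1 beta2) N] and [Re (c h3^H a21) <= |c| |h3^H a21|].  The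
    proposed phases align all [N] terms with the conjugate of [h3^H a21], so
    that both inequalities become equalities. *)

Lemma cabs_sq (R : realType) (a b : R) :
  cabs (a +i* b) ^+ 2 = a ^+ 2 + b ^+ 2.
Proof. by rewrite /cabs /= sqr_sqrtr // addr_ge0 ?sqr_ge0. Qed.

Lemma cabs_ge0 (R : realType) (z : R[i]) : 0 <= cabs z.
Proof. by case: z => a b; exact: sqrtr_ge0. Qed.

Lemma cabsM (R : realType) (x y : R[i]) : cabs (x * y) = cabs x * cabs y.
Proof. exact: Normc.normcM. Qed.

Lemma cabs_real (R : realType) (r : R) : 0 <= r -> cabs r%:C = r.
Proof. by move=> r0; rewrite /cabs /= expr0n addr0 sqrtr_sqr ger0_norm. Qed.

Lemma cabs_sum (R : realType) n (F : 'I_n -> R[i]) :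
  cabs (\sum_i F i) <= \sum_i cabs (F i).
Proof.
elim/big_rec2: _ => [|i x y _ yx]; first by rewrite (cabs_real _ _ (lexx 0)).
by apply: le_trans (le_normcD _ _) _; rewrite lerD2l.
Qed.

Lemma cabs_expj (R : realType) (t : R) : cabs (expj t) = 1.
Proof. by rewrite /cabs /= cos2Dsin2 sqrtr1. Qed.

Lemma expjD (R : realType) (s t : R) : expj (s + t) = expj s * expj t.
Proof. by rewrite /expj cosD sinD; simpc; rewrite [X in _ +i* X]addrC. Qed.

Lemma expj0 (R : realType) : expj 0 = 1 :> R[i].
Proof. by rewrite /expj cos0 sin0. Qed.

(** The conjugate falls on the first summand to match [hdot], so that summing over the entries gives
    the cross term of [enormD_sq]. *)
Lemma cabsD_sq (R : realType) (x y : R[i]) :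
  cabs (x + y) ^+ 2 = cabs x ^+ 2 + cabs y ^+ 2 + 2 * complex.Re (x^* * y).
Proof.
case: x y => [a b] [c d]; rewrite [_ +i* _ + _]/GRing.add /= !cabs_sq /=; ring.
Qed.

Lemma Re_le_cabs (R : realType) (z : R[i]) : complex.Re z <= cabs z.
Proof.
case: z => a b; apply: le_trans (ler_norm a) _.
by rewrite /cabs /= -sqrtr_sqr ler_wsqrtr // lerDl sqr_ge0.
Qed.

Lemma enorm_sq (R : realType) n (v : 'cV[R[i]]_n) :
  enorm v ^+ 2 = \sum_i cabs (v i 0) ^+ 2.
Proof. by rewrite /enorm sqr_sqrtr // sumr_ge0 // => i _; exact: sqr_ge0. Qed.

Lemma hdotE (R : realType) n (u v : 'cV[R[i]]_n) :
  hdot u v = \sum_i (u i 0)^* * v i 0.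
Proof. by rewrite /hdot mxE; apply: eq_bigr => i _; rewrite !mxE. Qed.

Lemma hdotZr (R : realType) n (c : R[i]) (u v : 'cV[R[i]]_n) :
  hdot u (c *: v) = c * hdot u v.
Proof. by rewrite /hdot -scalemxAr mxE. Qed.

Lemma enormD_sq (R : realType) n (u v : 'cV[R[i]]_n) :
  enorm (u + v) ^+ 2 = enorm u ^+ 2 + enorm v ^+ 2 + 2 * complex.Re (hdot u v).
Proof.
rewrite hdotE raddf_sum mulr_sumr !enorm_sq -!big_split /=.
by apply: eq_bigr => i _; rewrite mxE cabsD_sq.
Qed.

Lemma enormZ_sq (R : realType) n (c : R[i]) (v : 'cV[R[i]]_n) :
  enorm (c *: v) ^+ 2 = cabs c ^+ 2 * enorm v ^+ 2.
Proof.
rewrite !enorm_sq mulr_sumr.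
by apply: eq_bigr => i _; rewrite mxE cabsM exprMn.
Qed.

Lemma enorm_unimodular_sq (R : realType) n (v : 'cV[R[i]]_n) :
  unimodular v -> enorm v ^+ 2 = n%:R.
Proof.
move=> hv; rewrite enorm_sq (eq_bigr (fun=> 1)) => [|i _].
  by rewrite sumr_const card_ord.
by rewrite hv expr1n.
Qed.

(** A unit-modulus number is the exponential of its argument. This lets the proposed phases cancel
    the entries of [a1] and [a22] one at a time. *)
Lemma unimodular_expjN (R : realType) (z : R[i]) (t : R) :
  cabs z = 1 -> is_arg z t -> z * expj (- t) = 1.
Proof. by rewrite /is_arg => -> ->; rewrite mul1r -expjD subrr expj0. Qed.

(** After reassociation, [a22^T *m diag_mx psi *m a1] is a 1 by 1 matrix, hence a scalar that can be
    pulled out in front of [a21]. *)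
Lemma rank1_channelE (R : realType) M N (b1 b2 : R[i]) (a1 a22 : 'cV[R[i]]_N)
    (a21 : 'cV[R[i]]_M) (psi : 'rV[R[i]]_N) :
  b2 *: (a21 *m a22^T) *m diag_mx psi *m (b1 *: a1) =
  (b1 * b2 * \sum_n a22 n 0 * psi 0 n * a1 n 0) *: a21.
Proof.
set S := \sum_n _.
have -> : b2 *: (a21 *m a22^T) *m diag_mx psi *m (b1 *: a1) =
    (b1 * b2) *: (a21 *m (a22^T *m diag_mx psi *m a1)).
  by rewrite -scalemxAr -!scalemxAl scalerA !mulmxA.
have -> : a22^T *m diag_mx psi *m a1 = S%:M.
  apply/matrixP=> i j; rewrite !ord1 mul_mx_diag !mxE eqxx mulr1n.
  by apply: eq_bigr => n _; rewrite !mxE.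
by rewrite mul_mx_scalar scalerA.
Qed.

Theorem mainTheorem8 (R : realType) (M N : nat) (hM : (1 <= M)%N)
    (hN : (1 <= N)%N) (P sigma2 beta1 beta2 : R)
    (hP : 0 < P) (hsigma2 : 0 < sigma2) (hbeta1 : 0 < beta1) (hbeta2 : 0 < beta2)
    (a1 a22 : 'cV[R[i]]_N) (a21 : 'cV[R[i]]_M)
    (ha1 : unimodular a1) (ha22 : unimodular a22) (ha21 : unimodular a21)
    (h3 : 'cV[R[i]]_M)
    (angle : R[i] -> R) (hangle : forall z : R[i], is_arg z (angle z)) :
  let h1 : 'cV[R[i]]_N := (Num.sqrt beta1)%:C *: a1 in
  let H2 : 'M[R[i]]_(M, N) := (Num.sqrt beta2)%:C *: (a21 *m a22^T) in
  let psi_opt : 'rV[R[i]]_N :=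
    \row_(n < N) expj (- angle (a1 n 0) - angle (a22 n 0) - angle (hdot h3 a21)) in
  [/\ unimodular psi_opt,
      forall psi : 'rV[R[i]]_N, unimodular psi ->
        SNR P sigma2 h3 H2 h1 psi <= SNR P sigma2 h3 H2 h1 psi_opt
    & SNR P sigma2 h3 H2 h1 psi_opt =
        P * (enorm h3 ^+ 2 + beta1 * beta2 * N%:R ^+ 2 * M%:R
             + 2 * Num.sqrt (beta1 * beta2) * N%:R * cabs (hdot h3 a21))
        / sigma2].
Proof.
move=> h1 H2 psi_opt.
set d := hdot h3 a21; set g : R := Num.sqrt (beta1 * beta2).
pose s (psi : 'rV[R[i]]_N) := \sum_n a22 n 0 * psi 0 n * a1 n 0.
have g0 : 0 <= g by exact: sqrtr_ge0.
have g2 : g ^+ 2 = beta1 * beta2 by rewrite sqr_sqrtr // mulr_ge0 ?ltW.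
(* The phases enter the SNR only through the scalar [s psi]; the two path amplitudes merge into
   [g]. *)
have hSNR psi : SNR P sigma2 h3 H2 h1 psi = P / sigma2 *
    (enorm h3 ^+ 2 + (g * cabs (s psi)) ^+ 2 * M%:R
     + 2 * complex.Re (g%:C * s psi * d)).
  rewrite /SNR /H2 /h1 rank1_channelE -rmorphM -sqrtrM ?ltW //= -/g -/(s psi).
  by rewrite enormD_sq hdotZr enormZ_sq (enorm_unimodular_sq _ _ _ ha21) cabsM cabs_real.
(* Triangle inequality: each of the [N] terms has modulus 1. *)
have s_le psi : unimodular psi -> cabs (s psi) <= N%:R.
  move=> hpsi; apply: le_trans (cabs_sum _ _ _) _.
  rewrite (eq_bigr (fun=> 1)) ?sumr_const ?card_ord // => n _.
  by rewrite !cabsM ha22 hpsi ha1 !mulr1.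
have s_opt : s psi_opt = N%:R%:C * expj (- angle d).
  rewrite /s (eq_bigr (fun=> expj (- angle d))) => [|n _].
    rewrite sumr_const card_ord -[LHS]mulr_natl.
    by rewrite -(rmorph_nat (real_complex R) N).
  (* Regroup so that each channel entry meets the phase that cancels it; only the factor common to
     all [n] survives. *)
  rewrite mxE !expjD -/d; transitivity
      ((a22 n 0 * expj (- angle (a22 n 0))) * (a1 n 0 * expj (- angle (a1 n 0)))
       * expj (- angle d)); first by ring.
  rewrite (unimodular_expjN _ _ _ (ha22 n 0)) //.
  by rewrite (unimodular_expjN _ _ _ (ha1 n 0)) // mulr1 mul1r.
have opt_value : SNR P sigma2 h3 H2 h1 psi_opt = P / sigma2 *
    (enorm h3 ^+ 2 + (g * N%:R) ^+ 2 * M%:R + 2 * (g * N%:R * cabs d)).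
  rewrite hSNR s_opt cabsM cabs_expj mulr1 cabs_real ?ler0n //.
  (* The remaining phase cancels that of [d], so the product is a nonnegative real and equals its
     own real part. This also covers [d = 0], where [angle d] is arbitrary. *)
  have -> : g%:C * (N%:R%:C * expj (- angle d)) * d
            = (g * N%:R * cabs d)%:C.
    rewrite {2}(hangle d) !rmorphM /=.
    have e : expj (- angle d) * expj (angle d) = 1.
      by rewrite -expjD addNr expj0.
    by rewrite -[RHS]mulr1 -e; ring.
  by [].
split.
- by move=> i n; rewrite mxE cabs_expj.
- move=> psi /s_le hs; rewrite opt_value hSNR.
  have gs : g * cabs (s psi) <= g * N%:R by rewrite ler_wpM2l.
  have gs0 : 0 <= g * cabs (s psi) by rewrite mulr_ge0 ?cabs_ge0.
  have Ps : 0 <= P / sigma2 by rewrite divr_ge0 ?ltW.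
  (* The term in [h3] is common; the quadratic and the cross term are bounded separately, both by
     [gs]. *)
  rewrite ler_wpM2l // -!addrA lerD2l lerD //.
    by rewrite ler_wpM2r ?ler0n // lerXn2r // nnegrE // (le_trans gs0).
  (* Bounding the real part by the modulus discards the phase of [s psi * d]; what is left is [gs]
     times [cabs d]. *)
  rewrite ler_wpM2l //; apply: le_trans (Re_le_cabs _ _) _.
  by rewrite !cabsM cabs_real // ler_wpM2r ?cabs_ge0.
- by rewrite opt_value exprMn g2; field; rewrite gt_eqF.
Qed.
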